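(* Let $D\subseteq\mathbb{R}^n$ be nonempty, convex and closed, let $f:\mathbb{R}^n\to\mathbb{R}$ be locally Lipschitz on $D$, and put $f^*=\inf_{x\in D}f(x)$. Let $\gamma>f^*$ be a number such that $D_\gamma=\{x\in D: f(x)\le\gamma\}$ is bounded. Let $D^*=\{x\in D: f(x)=f^*\}$ and let $D^0$ be the set of stationary points, i.e. of all $x^*\in D$ for which there is $g^*\in\partial^{\uparrow}f(x^* )$ with $\langle g^*,x-x^*\rangle\ge 0$ for all $x\in D$. Let $x\mapsto y(x)$ be a single-valued mapping from $D$ into $D$ and $\tau>0$ a number such that: (1) $y(\cdot)$ is continuous on $D$; (2) for $\bar x\in D$, $\bar x=y(\bar x)$ if and only if $\bar x\in D^0$; (3) for every $x\in D$ and every $g\in\partial^{\uparrow}f(x)$, $\langle g,y(x)-x\rangle\le-\tau\|y(x)-x\|^2$. Let $\beta\in(0,1)$ with $\beta<\tau$, and let $\{x^k\}_{k\ge0}$ be any infinite sequence generated by Method (SBM) (described in the context) with these data; that is, the method does not terminate. Then: (i) The sequence $\{x^k\}$ has a limit point which belongs to $D^0$. (ii) If $D^*=D^0$, then all the limit points of $\{x^k\}$ belong to $D^*$, and moreover $\lim_{k\to\infty}f(x^k)=f^*$.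
   Context: ''Locally Lipschitz on $D$'' means that $f$ is Lipschitz continuous in a neighborhood (in $\mathbb{R}^n$) of every point of $D$. The Clarke upper derivative is $f^{\uparrow}(x;p)=\limsup_{y\to x,\ \alpha\searrow0}(f(y+\alpha p)-f(y))/\alpha$, and the generalized gradient set is $\partial^{\uparrow}f(x)=\{g\in\mathbb{R}^n:\langle g,p\rangle\le f^{\uparrow}(x;p)\ \forall p\in\mathbb{R}^n\}$. A limit point of a sequence is a limit of some subsequence. Method (SBM), for data $D,f,\gamma,y(\cdot),\beta$: Step 0. Choose $x^0\in D_\gamma$, $\beta\in(0,1)$, and a sequence $\{\tau_l\}_{l\ge0}$ with $\tau_l\in(0,1)$ and $\tau_l\to0$. Set $k=0$, $l=0$, $u^0=x^0$, and choose $\lambda_0\in(0,\tau_0]$. Step 1. Set $y^k=y(x^k)$. If $y^k=x^k$, stop. Otherwise set $d^k=y^k-x^k$ and $z^{k+1}=x^k+\lambda_kd^k$. Step 2. If $f(z^{k+1})\le f(x^k)-\beta\lambda_k\|d^k\|^2$, choose any $\lambda_{k+1}\in[\lambda_k,\tau_l]$ (with $l$ unchanged), set $x^{k+1}=z^{k+1}$ and go to Step 4. Step 3. (Otherwise.) Set $\lambda'_{k+1}=\min\{\lambda_k,\tau_{l+1}\}$, then replace $l$ by $l+1$, and choose any $\lambda_{k+1}\in(0,\lambda'_{k+1}]$. If $f(z^{k+1})\le\gamma$, set $x^{k+1}=z^{k+1}$ and go to Step 4. Otherwise set $x^{k+1}=u^k$, $u^{k+1}=u^k$, replace $k$ by $k+1$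 and go to Step 1. Step 4. If $f(x^{k+1})<f(u^k)$, set $u^{k+1}=x^{k+1}$; otherwise set $u^{k+1}=u^k$. Replace $k$ by $k+1$ and go to Step 1. Thus $u^k$ is a best point so far: $f(u^k)=\min_{0\le i\le k}f(x^i)$. *)

(* Defs.v *)
(* MathComp-Analysis; R^n is 'rV[R]_n. *)
From HB Require Import structures.
From mathcomp Require Import all_boot all_order all_algebra.
From mathcomp Require Import all_classical all_reals all_analysis.
Set Implicit Arguments.
Unset Strict Implicit.
Unset Printing Implicit Defensive.
Import Order.TTheory GRing.Theory Num.Theory.
Import numFieldNormedType.Exports.
Local Open Scope classical_set_scope.
Local Open Scope ring_scope.

Definition dotv (R : realType) (n : nat) (u v : 'rV[R]_n) : R :=
  \sum_(i < n) u 0 i * v 0 i.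

(* The Euclidean norm, as opposed to the library's `|u|, which on 'rV[R]_n is
   the sup norm. The latter is used below only through notions that do not
   depend on the choice of a norm (topology, boundedness, being Lipschitz). *)
Definition enorm (R : realType) (n : nat) (u : 'rV[R]_n) : R :=
  Num.sqrt (dotv u u).

Definition locally_lipschitz_on (R : realType) (n : nat) (D : set 'rV[R]_n)
    (f : 'rV[R]_n -> R) : Prop :=
  forall x, D x -> exists2 U, nbhs x U & [lipschitz f z | z in U].

Definition clarke_upper (R : realType) (n : nat) (f : 'rV[R]_n -> R)
    (x p : 'rV[R]_n) : \bar R :=
  limf_esup
    (fun ya : 'rV[R]_n * R => ((f (ya.1 + ya.2 *: p) - f ya.1) / ya.2)%:E)
    (filter_prod (nbhs x) (0^'+)).

Definition gengrad (R : realType) (n : nat) (f : 'rV[R]_n -> R)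
    (x : 'rV[R]_n) : set 'rV[R]_n :=
  [set g | forall p, ((dotv g p)%:E <= clarke_upper f x p)%E].

Definition sublevel (R : realType) (n : nat) (D : set 'rV[R]_n)
    (f : 'rV[R]_n -> R) (gamma : R) : set 'rV[R]_n :=
  [set x | D x /\ f x <= gamma].

(* In \bar R, because the real-valued [inf] of a set that is not bounded below
   is a junk value. *)
Definition optval (R : realType) (n : nat) (D : set 'rV[R]_n)
    (f : 'rV[R]_n -> R) : \bar R :=
  ereal_inf [set (f x)%:E | x in D].

Definition solutions (R : realType) (n : nat) (D : set 'rV[R]_n)
    (f : 'rV[R]_n -> R) : set 'rV[R]_n :=
  [set x | D x /\ (f x)%:E = optval D f].

Definition stationary (R : realType) (n : nat) (D : set 'rV[R]_n)
    (f : 'rV[R]_n -> R) : set 'rV[R]_n :=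
  [set xs | D xs /\
    exists2 g, gengrad f xs g & forall x, D x -> 0 <= dotv g (x - xs)].

Definition subseq_limit (R : realType) (n : nat) (x : nat -> 'rV[R]_n)
    (z : 'rV[R]_n) : Prop :=
  exists2 phi : nat -> nat,
    {homo phi : i j / (i < j)%N} & x (phi k) @[k --> \oo] --> z.

(* (x^k, u^k, lambda_k, l), where l is the current index into the sequence tau. *)
Record sbm_state (R : realType) (n : nat) := SbmState {
  iter_pt : 'rV[R]_n;
  best_pt : 'rV[R]_n;
  stepsize : R;
  level : nat }.

Definition sbm_trial (R : realType) (n : nat) (y : 'rV[R]_n -> 'rV[R]_n)
    (s : sbm_state R n) : 'rV[R]_n :=
  iter_pt s + stepsize s *: (y (iter_pt s) - iter_pt s).

Definition sbm_descent (R : realType) (n : nat) (f : 'rV[R]_n -> R)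
    (y : 'rV[R]_n -> 'rV[R]_n) (beta : R) (s : sbm_state R n) : Prop :=
  f (sbm_trial y s) <=
    f (iter_pt s) - beta * stepsize s * enorm (y (iter_pt s) - iter_pt s) ^+ 2.

Definition sbm_best (R : realType) (n : nat) (f : 'rV[R]_n -> R)
    (u x : 'rV[R]_n) : 'rV[R]_n :=
  if f x < f u then x else u.

(* One iteration that does not stop. In SbmDescent the trial point passes the
   descent test; in the other two cases it fails it, and the method moves to the
   trial point all the same if it lies in the gamma-sublevel set, or else goes
   back to the best point. *)
Variant sbm_step (R : realType) (n : nat) (f : 'rV[R]_n -> R) (gamma : R)
    (y : 'rV[R]_n -> 'rV[R]_n) (beta : R) (taus : nat -> R)
    (s : sbm_state R n) : sbm_state R n -> Prop :=
| SbmDescent (lam : R) of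
    y (iter_pt s) <> iter_pt s &
    sbm_descent f y beta s &
    stepsize s <= lam <= taus (level s) :
    sbm_step f gamma y beta taus s
      (SbmState (sbm_trial y s) (sbm_best f (best_pt s) (sbm_trial y s))
                lam (level s))
| SbmAccept (lam : R) of
    y (iter_pt s) <> iter_pt s &
    ~ sbm_descent f y beta s &
    0 < lam <= Num.min (stepsize s) (taus (level s).+1) &
    f (sbm_trial y s) <= gamma :
    sbm_step f gamma y beta taus s
      (SbmState (sbm_trial y s) (sbm_best f (best_pt s) (sbm_trial y s))
                lam (level s).+1)
| SbmReturn (lam : R) of
    y (iter_pt s) <> iter_pt s &
    ~ sbm_descent f y beta s &
    0 < lam <= Num.min (stepsize s) (taus (level s).+1) &
    gamma < f (sbm_trial y s) :
    sbm_step f gamma y beta taus s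
      (SbmState (best_pt s) (best_pt s) lam (level s).+1).

Definition sbm_init (R : realType) (n : nat) (D : set 'rV[R]_n)
    (f : 'rV[R]_n -> R) (gamma : R) (taus : nat -> R)
    (s : sbm_state R n) : Prop :=
  [/\ sublevel D f gamma (iter_pt s), best_pt s = iter_pt s,
      0 < stepsize s <= taus 0%N & level s = 0%N].

Definition sbm_sequence (R : realType) (n : nat) (D : set 'rV[R]_n)
    (f : 'rV[R]_n -> R) (gamma : R) (y : 'rV[R]_n -> 'rV[R]_n) (beta : R)
    (x : nat -> 'rV[R]_n) : Prop :=
  exists (taus : nat -> R) (s : nat -> sbm_state R n),
    [/\ (forall l, 0 < taus l < 1) /\ taus l @[l --> \oo] --> 0,
        sbm_init D f gamma taus (s 0%N),
        forall k, sbm_step f gamma y beta taus (s k) (s k.+1) &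
        forall k, x k = iter_pt (s k)].

(* Main.v *)
Require Import Defs.
From HB Require Import structures.
From mathcomp Require Import all_boot all_order all_algebra.
From mathcomp Require Import all_classical all_reals all_analysis.
From mathcomp Require Import ring lra.
Set Implicit Arguments.
Unset Strict Implicit.
Unset Printing Implicit Defensive.
Import Order.TTheory GRing.Theory Num.Theory.
Import numFieldNormedType.Exports.
Local Open Scope classical_set_scope.
Local Open Scope ring_scope.

(** The key fact is local ([locally_uniform_descent]): around a point of [D] that
is not stationary, the descent test passes at every point of [D] and for every
sufficiently small step. To see this, let [d = y x - x], which is nonzero by
condition (2). The Clarke upper derivative of a locally Lipschitz function is
finite and sublinear in the direction, so by the Hahn-Banach theorem
([hahn_banach_dotv]) its value at [d] is attained by some generalized gradient
([gengrad_attains]), and condition (3) bounds it by [- tau] times the squared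
Euclidean norm of [d]. The upper derivative is an upper limit over base points
as well, hence this bound holds, up to a small error, for the difference
quotients at all nearby points. Since [f] is Lipschitz there and [y] is
continuous, [d] may be replaced by the direction at the nearby point, and
[beta < tau] leaves room for the errors.

All iterates lie in the compact sublevel set ([run_invariant],
[sublevel_closed]), so limit points exist. Two cases arise.

If the descent test fails infinitely often, the steps tend to 0
([steps_vanish]), and by the local fact every limit point of the iterates at
which the test fails is stationary ([fails_limit]). If it fails only finitely
often, the steps stay bounded away from 0 while [f] decreases and is bounded
below along a convergent subsequence, so the directions tend to 0 along it and
its limit is stationary ([nofails_limit]). This gives the first claim.

Now suppose that the stationary points are the minimizers. At a late failure
the value of [f] is close to the minimum by the preceding argument; so is the
next value, because the next iterate is either the trial point, which is close
to the current one ([trial_limit]), or the best point, at which [f] is no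
larger. Between failures the values decrease. Hence they converge to the
minimum ([values_below]), and every limit point is a minimizer by continuity. *)

(** * Sublinear functions and the Hahn-Banach theorem *)

Definition sublinear (R : realType) (V : lmodType R) (P : V -> R) : Prop :=
  (forall u v, P (u + v) <= P u + P v) /\
  (forall t u, 0 < t -> P (t *: u) = t * P u).

Section Sublinear.
Variables (R : realType) (V : lmodType R).
Implicit Types (P Q : V -> R) (u v w : V).

(** Homogeneity follows from one inequality, applied to [t] and to [t^-1]. *)
Lemma sublinearI P : (forall u v, P (u + v) <= P u + P v) ->
  (forall t u, 0 < t -> P (t *: u) <= t * P u) -> sublinear P.
Proof.
move=> subadd subhom; split=> // t u t0.
apply/eqP; rewrite eq_le subhom//=.
have ti : 0 < t^-1 by rewrite invr_gt0.
have := subhom _ (t *: u) ti.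
by rewrite scalerA mulVf ?gt_eqF// scale1r mulrC ler_pdivlMr// mulrC.
Qed.

Lemma sublinear0 P : sublinear P -> P 0 = 0.
Proof.
move=> [_ hom]; have := hom 2 0 (ltr0n _ 2).
by rewrite scaler0; lra.
Qed.

Lemma sublinearN P u : sublinear P -> - P (- u) <= P u.
Proof.
move=> sP; have := sP.1 u (- u).
by rewrite subrr sublinear0//; lra.
Qed.

Lemma sublinearZ_le P t u : sublinear P -> t * P u <= P (t *: u).
Proof.
move=> sP; have [t0|t0|->] := ltgtP t 0; last first.
- by rewrite scale0r mul0r sublinear0.
- by rewrite sP.2.
- have Nt0 : 0 < - t by rewrite oppr_gt0.
  have -> : t *: u = (- t) *: (- u) by rewrite scalerN scaleNr opprK.
  rewrite sP.2// -[X in X * _](opprK t) mulNr -mulrN ler_pM2l//.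
  by have := sublinearN (- u) sP; rewrite opprK; lra.
Qed.

(** The infimal convolution of [P] with the function that is [- t * P v] at
[- t *: v] for [t >= 0] and [+oo] elsewhere: forcing the value at [- v] down to
[- P v] makes [P] linear along [v] while keeping it sublinear. *)
Definition relax P v u : R :=
  inf [set P (u + t *: v) - t * P v | t in [set t | 0 <= t]].

(** [- P (- u)] bounds the infimum from below, because
[P (t *: v) <= P (u + t *: v) + P (- u)]. *)
Lemma relax_has_inf P v u : sublinear P ->
  has_inf [set P (u + t *: v) - t * P v | t in [set t | 0 <= t]].
Proof.
move=> sP; split.
  by exists (P (u + 0 *: v) - 0 * P v); exists 0 => //=.
exists (- P (- u)) => _ [t /= t0 <-].
have := sP.1 (u + t *: v) (- u).
rewrite addrAC subrr add0r.
have := sublinearZ_le t v sP; lra.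
Qed.

Lemma relax_le_at P v u t : sublinear P -> 0 <= t ->
  relax P v u <= P (u + t *: v) - t * P v.
Proof.
move=> sP t0; apply: ge_inf; first exact: (relax_has_inf v u sP).2.
by exists t.
Qed.

Lemma relax_approx P v u e : sublinear P -> 0 < e ->
  exists2 t, 0 <= t & P (u + t *: v) - t * P v < relax P v u + e.
Proof.
move=> sP e0.
have [_ [t t0 <-] H] := inf_adherent e0 (relax_has_inf v u sP).
by exists t.
Qed.

Lemma relax_le P v u : sublinear P -> relax P v u <= P u.
Proof.
move=> sP; have := relax_le_at v u sP (lexx 0).
by rewrite scale0r mul0r addr0 subr0.
Qed.

Lemma relax_opp P v : sublinear P -> relax P v (- v) <= - P v.
Proof.
move=> sP; have := relax_le_at v (- v) sP ler01.
by rewrite scale1r mul1r addNr sublinear0// sub0r.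
Qed.

Lemma sublinear_relax P v : sublinear P -> sublinear (relax P v).
Proof.
move=> sP; apply: sublinearI => [u w|t u t0].
  apply/ler_addgt0Pr => e e0.
  have e20 : 0 < e / 2 by rewrite divr_gt0.
  have [s s0 Hs] := relax_approx v u sP e20.
  have [t t0 Ht] := relax_approx v w sP e20.
  apply: (le_trans (relax_le_at v (u + w) sP (addr_ge0 s0 t0))).
  have := sP.1 (u + s *: v) (w + t *: v).
  by rewrite scalerDl addrACA; lra.
apply/ler_addgt0Pr => e e0.
have [s s0 Hs] := relax_approx v u sP (divr_gt0 e0 t0).
have ts0 : 0 <= t * s by rewrite mulr_ge0// ltW.
apply: (le_trans (relax_le_at v (t *: u) sP ts0)).
rewrite -scalerA -scalerDr sP.2// -mulrA -mulrBr.
have -> : t * relax P v u + e = t * (relax P v u + e / t).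
  by field; rewrite gt_eqF.
by rewrite ler_pM2l// ltW.
Qed.

(** Relaxing along the vectors of [s] one after the other never destroys what was
gained before: if [Q (- w) <= - Q w], then a smaller sublinear function [Q']
satisfies [Q' (- w) <= Q (- w) <= - Q w <= - Q' w]. *)
Lemma sublinear_minorant P (s : seq V) : sublinear P ->
  exists Q, [/\ sublinear Q, forall u, Q u <= P u &
    forall w, w \in s -> Q (- w) <= - Q w].
Proof.
move=> sP; elim: s => [|v s [Q [sQ QP Qs]]]; first by exists P.
have sQv := sublinear_relax v sQ.
exists (relax Q v); split => // [u|w].
  by apply: le_trans (QP u); exact: relax_le.
rewrite inE => /orP[/eqP ->|/Qs Qw].
  by apply: le_trans (relax_opp v sQ) _; rewrite lerN2; exact: relax_le.
apply: le_trans (relax_le _ _ sQ) _; apply: le_trans Qw _.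
by rewrite lerN2; exact: relax_le.
Qed.

Lemma sublinear_odd_le P t w : sublinear P -> P (- w) <= - P w ->
  P (t *: w) <= t * P w.
Proof.
move=> sP PN; have [t0|t0|->] := ltgtP t 0; last first.
- by rewrite scale0r mul0r sublinear0.
- by rewrite sP.2.
- have Nt0 : 0 < - t by rewrite oppr_gt0.
  have -> : t *: w = (- t) *: (- w) by rewrite scalerN scaleNr opprK.
  have -> : t * P w = (- t) * - P w by ring.
  by rewrite sP.2// ler_pM2l.
Qed.

End Sublinear.

(** The Hahn-Banach theorem in finite dimension: a sublinear function that is odd
on a basis is the linear form given by its values there, so it suffices to
relax [P] first along [d], which secures the value at [d], and then along the
standard basis. *)
Lemma hahn_banach_dotv (R : realType) (n : nat) (P : 'rV[R]_n -> R)
    (d : 'rV[R]_n) : sublinear P ->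
  exists2 g, forall u, dotv g u <= P u & P d <= dotv g d.
Proof.
move=> sP.
have [Q [sQ QP Qe]] := sublinear_minorant
  [seq delta_mx 0 i | i : 'I_n] (sublinear_relax d sP).
pose g : 'rV[R]_n := \row_i Q (delta_mx 0 i).
have QZ t i : Q (t *: delta_mx 0 i) <= t * Q (delta_mx 0 i).
  by apply: sublinear_odd_le => //; apply: Qe; rewrite map_f ?mem_enum.
have Qdot u : Q u <= dotv g u.
  rewrite {1}(row_sum_delta u) /dotv.
  elim/big_ind2 : _ => [|a b c e ab ce|i _].
  - by rewrite sublinear0.
  - by apply: le_trans (sQ.1 _ _) _; exact: lerD.
  - by rewrite mxE mulrC QZ.
have dotvN u : dotv g (- u) = - dotv g u.
  by rewrite /dotv -sumrN; apply: eq_bigr => i _; rewrite [(- u) 0 i]mxE mulrN.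
exists g => [u|].
  have h1 := Qdot (- u); rewrite dotvN in h1.
  have h2 := sublinearN u sQ.
  have h3 := QP u.
  have h4 := relax_le d u sP; lra.
have h1 := sublinearN (- d) sQ; rewrite opprK in h1.
have h2 := Qdot d.
have h3 := QP (- d).
have h4 := relax_opp d sP.
lra.
Qed.

(** * The Clarke upper derivative of a locally Lipschitz function *)

Definition lipschitz_ball (R : realType) (n : nat) (f : 'rV[R]_n -> R)
    (x : 'rV[R]_n) (L r : R) : Prop :=
  [/\ 0 < L, 0 < r & forall a b, `|a - x| < r -> `|b - x| < r ->
     `|f a - f b| <= L * `|a - b|].

Section Clarke.
Variables (R : realType) (n : nat) (f : 'rV[R]_n -> R).
Implicit Types (x p q d : 'rV[R]_n) (D : set 'rV[R]_n).

Lemma locally_lipschitz_ball D x : locally_lipschitz_on D f -> D x ->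
  exists L r, lipschitz_ball f x L r.
Proof.
move=> fl /fl[U Ux [M [_ HM]]].
have /nbhs_normP[r /= r0 rU] := Ux.
have L0 : 0 < Num.max (M + 1) 1 by rewrite lt_max ltr01 orbT.
exists (Num.max (M + 1) 1), r; split => // a b ax bx.
have ML : M < Num.max (M + 1) 1 by rewrite lt_max ltrDl ltr01.
apply: (HM _ ML (a, b)); split; apply: rU; by rewrite /= distrC.
Qed.

(** The upper limit along a product filter, unfolded into balls; all later
estimates of the upper derivative use this form. *)
Lemma clarke_leP x p (c : R) :
  (clarke_upper f x p <= c%:E)%E <->
  forall e, 0 < e -> exists2 r, 0 < r & forall z a,
    `|z - x| < r -> 0 < a < r -> f (z + a *: p) - f z <= a * (c + e).
Proof.
rewrite /clarke_upper limf_esupE; split.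
  move=> H e e0.
  have /ereal_inf_lt[_ [V [[A B] /= [xA B0] ABV] <-] Hs] :
      (ereal_inf [set ereal_sup
       ((fun ya : 'rV[R]_n * R => ((f (ya.1 + ya.2 *: p) - f ya.1) / ya.2)%:E)
        @` V) | V in filter_prod (nbhs x) (0^'+)] < (c + e)%:E)%E.
    by apply: le_lt_trans H _; rewrite lte_fin ltrDl.
  have /nbhs_normP[r /= r0 rA] := xA.
  have /nbhs_normP[s /= s0 sB] := B0.
  exists (Num.min r s); first by rewrite lt_min r0.
  move=> z a; rewrite lt_min => /andP[zr _] /andP[a0].
  rewrite lt_min => /andP[_ ars].
  have : V (z, a).
    apply: ABV; split => /=; first by apply: rA; rewrite /= distrC.
    by apply: sB => //=; rewrite sub0r normrN gtr0_norm.
  move=> Vza.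
  have : (((f (z + a *: p) - f z) / a)%:E < (c + e)%:E)%E.
    by apply: le_lt_trans Hs; apply: ereal_sup_ubound; exists (z, a).
  by rewrite lte_fin ltr_pdivrMr// mulrC => /ltW.
move=> H; apply/lee_addgt0Pr => e e0.
have [r r0 Hr] := H _ e0.
pose V : set ('rV[R]_n * R) := [set z | `|z.1 - x| < r /\ 0 < z.2 < r].
apply: (@le_trans _ _ (ereal_sup ((fun ya : 'rV[R]_n * R =>
  ((f (ya.1 + ya.2 *: p) - f ya.1) / ya.2)%:E) @` V))).
  apply: ereal_inf_lbound; exists V => //.
  exists ([set z | `|z - x| < r], [set a | 0 < a < r]) => /=.
    split.
      apply/(@nbhs_normP R 'rV[R]_n); exists r => //= z /=; by rewrite distrC.
    apply/(@nbhs_normP R R^o); exists r => //= a /=.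
    by rewrite sub0r normrN => ar a0; rewrite a0 (le_lt_trans (ler_norm a)).
  by move=> [z a] /= [].
apply: ge_ereal_sup => _ [[z a] /= [zr /andP[a0 ar]] <-].
rewrite lee_fin ler_pdivrMr// mulrC; apply: Hr => //.
by rewrite a0.
Qed.

Section Finite.
Variables (x : 'rV[R]_n) (L r : R).
Hypothesis fx_lip : lipschitz_ball f x L r.

Lemma small_step p (s : R) : 0 < s ->
  exists2 t, 0 < t & forall z a, `|z - x| < t -> 0 < a < t ->
    `|z - x| < s /\ `|z + a *: p - x| < s.
Proof.
move=> s0; have p1 : 0 < 1 + `|p| by rewrite ltr_pwDl.
have t0 : 0 < s / 2 / (1 + `|p|) by rewrite !divr_gt0.
exists (s / 2 / (1 + `|p|)) => // z a zx /andP[a0 ta].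
have zs : `|z - x| < s / 2.
  apply: (lt_le_trans zx); rewrite ler_pdivrMr// mulrDr mulr1 lerDl.
  by rewrite mulr_ge0// divr_ge0// ltW.
have aps : `|a *: p| < s / 2.
  rewrite normrZ gtr0_norm//.
  move: ta; rewrite ltr_pdivlMr//; apply: le_lt_trans.
  by rewrite mulrDr mulr1 lerDr ltW.
split; first by lra.
rewrite addrAC; apply: le_lt_trans (ler_normD _ _) _; lra.
Qed.

Lemma clarke_le_lip p : (clarke_upper f x p <= (L * `|p|)%:E)%E.
Proof.
have [L0 r0 H] := fx_lip.
apply/clarke_leP => e e0.
have [t t0 Ht] := small_step p r0.
exists t => // z a zx at0.
have [z1 z2] := Ht _ _ zx at0.
have := H _ _ z2 z1; rewrite addrAC subrr add0r normrZ.
have a0 : 0 < a by case/andP: at0.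
rewrite gtr0_norm// => h.
apply: le_trans (ler_norm _) _; apply: le_trans h _.
rewrite mulrDr mulrCA lerDl mulr_ge0// ltW//.
Qed.

(** This rules out the value [-oo] as well: the real [c] is arbitrary. *)
Lemma clarke_ge_lip p (c : R) :
  (clarke_upper f x p <= c%:E)%E -> - (L * `|p|) <= c.
Proof.
have [L0 r0 H] := fx_lip.
move=> /clarke_leP Hc; apply/ler_addgt0Pr => e e0.
have [s s0 Hs] := Hc _ e0.
have [t t0 Ht] := small_step p r0.
pose a := Num.min s t / 2.
have m0 : 0 < Num.min s t by rewrite lt_min s0.
have a0 : 0 < a by rewrite divr_gt0.
have am : a < Num.min s t by rewrite /a; lra.
have [az at0] : a < s /\ a < t by move: am; rewrite lt_min => /andP.
have [||z1 z2] := Ht x a; rewrite ?subrr ?normr0// ?a0//.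
have := Hs x a; rewrite subrr normr0 s0 a0 az => /(_ isT isT).
have := H _ _ z2 z1; rewrite addrAC subrr add0r normrZ gtr0_norm//.
rewrite ler_norml => /andP[h _] h2.
rewrite -(ler_pM2l a0) mulrN mulrCA; lra.
Qed.

Lemma clarke_fin p : (fine (clarke_upper f x p))%:E = clarke_upper f x p.
Proof.
have := clarke_le_lip p; have := @clarke_ge_lip p.
case: (clarke_upper f x p) => [u|_ +|h _] //=.
by exfalso; have := h (- (L * `|p|) - 1) (leNye _); lra.
Qed.

Lemma clarke_fine_leP p (c : R) : fine (clarke_upper f x p) <= c <->
  forall e, 0 < e -> exists2 r, 0 < r & forall z a,
    `|z - x| < r -> 0 < a < r -> f (z + a *: p) - f z <= a * (c + e).
Proof. by rewrite -clarke_leP -clarke_fin lee_fin. Qed.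

(** Subadditivity comes from the decomposition
[f (z + a *: (u + v)) - f z = (f (z' + a *: v) - f z') + (f (z + a *: u) - f z)]
with [z' = z + a *: u]: the base point varies in the upper limit, so that the
quotient at [z'] is controlled as well. *)
Lemma clarke_sublinear : sublinear (fun p => fine (clarke_upper f x p)).
Proof.
apply: sublinearI => [u v|t u t0]; apply/clarke_fine_leP => e e0.
  have e20 : 0 < e / 2 by rewrite divr_gt0.
  have /clarke_fine_leP/(_ _ e20) [s s0 Hs] :=
    lexx (fine (clarke_upper f x u)).
  have /clarke_fine_leP/(_ _ e20) [s' s'0 Hs'] :=
    lexx (fine (clarke_upper f x v)).
  have m0 : 0 < Num.min s s' by rewrite lt_min s0.
  have [t t0 Ht] := small_step u m0.
  exists (Num.min t (Num.min s s')); first by rewrite lt_min t0.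
  move=> z a; rewrite !lt_min => /and3P[zt zs zs'] /and4P[a0 at0 as0 as'].
  have [|_] := Ht z a zt; first by rewrite a0.
  rewrite lt_min => /andP[_ zas'].
  have := Hs z a zs; rewrite a0 as0 => /(_ isT) h1.
  have := Hs' _ a zas'; rewrite a0 as' => /(_ isT) h2.
  by move: h1 h2; rewrite scalerDr addrA !mulrDr; lra.
have /clarke_fine_leP/(_ _ (divr_gt0 e0 t0)) [s s0 Hs] :=
  lexx (fine (clarke_upper f x u)).
exists (Num.min s (s / t)); first by rewrite lt_min s0 divr_gt0.
move=> z a; rewrite !lt_min => /andP[zs _] /and3P[a0 _ ast].
rewrite scalerA; apply: le_trans (Hs z (a * t) zs _) _.
  by rewrite mulr_gt0// -ltr_pdivlMr.
suff -> : a * t * (fine (clarke_upper f x u) + e / t) =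
          a * (t * fine (clarke_upper f x u) + e) by [].
by field; rewrite gt_eqF.
Qed.

(** The upper derivative is the support function of the generalized gradient, and
the supremum is attained; this turns a bound on all generalized gradients into
a bound on the difference quotients of [f]. *)
Lemma gengrad_attains d :
  exists2 g, gengrad f x g & (clarke_upper f x d <= (dotv g d)%:E)%E.
Proof.
have [g gP gd] := hahn_banach_dotv d clarke_sublinear.
exists g => [p|]; by rewrite -clarke_fin lee_fin.
Qed.

End Finite.
End Clarke.

(** * The Euclidean norm, and uniform descent near a non-fixed point *)

Section Euclidean.
Variables (R : realType) (n : nat).
Implicit Types (u v : 'rV[R]_n).

Lemma enorm_sqr u : enorm u ^+ 2 = \sum_(i < n) u 0 i ^+ 2.
Proof.
rewrite sqr_sqrtr; last first.
  by apply: sumr_ge0 => i _; rewrite -expr2 sqr_ge0.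
by apply: eq_bigr => i _; rewrite expr2.
Qed.

Lemma enorm_sqr_gt0 u : u != 0 -> 0 < enorm u ^+ 2.
Proof.
have ge0 (i : 'I_n) : true -> 0 <= u 0 i ^+ 2 by rewrite sqr_ge0.
move=> u0; rewrite enorm_sqr lt_def sumr_ge0// andbT.
apply: contra u0; rewrite psumr_eq0// => /allP u0; apply/eqP/rowP => i.
by have := u0 i; rewrite mem_index_enum sqrf_eq0 mxE => /(_ isT)/eqP.
Qed.

Lemma cvg_enorm_sqr (T : Type) (F : set_system T) (FF : Filter F)
    (u : T -> 'rV[R]_n) (v : 'rV[R]_n) :
  u t @[t --> F] --> v -> enorm (u t) ^+ 2 @[t --> F] --> enorm v ^+ 2.
Proof.
move=> uv; rewrite enorm_sqr.
under eq_fun do rewrite enorm_sqr.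
apply: cvg_big => // [|i _]; first exact: add_continuous.
have ci : u t 0 i @[t --> F] --> v 0 i.
  exact: (cvg_comp _ _ uv (@coord_continuous _ _ _ 0 i v)).
by rewrite expr2; under eq_fun do rewrite expr2; exact: cvgM.
Qed.

End Euclidean.

Lemma lipschitz_ball_continuous (R : realType) (n : nat) (f : 'rV[R]_n -> R)
    (x : 'rV[R]_n) (L r : R) :
  lipschitz_ball f x L r -> {for x, continuous f}.
Proof.
move=> [L0 r0 H]; apply/(@cvgrPdist_lt _ _ _ _ (nbhs_filter x)) => e e0.
have m0 : 0 < Num.min r (e / L) by rewrite lt_min r0 divr_gt0.
apply/(@nbhs_normP R 'rV[R]_n); exists (Num.min r (e / L)) => // z /=.
rewrite lt_min => /andP[zr ze].
apply: le_lt_trans (H _ _ _ _) _; rewrite ?subrr ?normr0//; last first.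
  by rewrite mulrC -ltr_pdivlMr.
by rewrite distrC.
Qed.

(** The descent test succeeds at every point near a non-fixed [x] of [y], for
every small step. Along the fixed direction [d = y x - x] the difference
quotients near [x] are at most about [- tau * N], where [N] is the squared
length of [d]. Replacing [d] by the direction at [z] costs at most [L] times
the distance of the two directions, which the continuity of [y] makes small,
and the gap between [beta] and [tau] absorbs all the errors. *)
Lemma locally_uniform_descent (R : realType) (n : nat) (D : set 'rV[R]_n)
    (f : 'rV[R]_n -> R) (y : 'rV[R]_n -> 'rV[R]_n) (tau beta : R)
    (x : 'rV[R]_n) :
  locally_lipschitz_on D f -> {within D, continuous y} -> D x -> y x <> x ->
  beta < tau ->
  (forall g, gengrad f x g ->
     dotv g (y x - x) <= - tau * enorm (y x - x) ^+ 2) ->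
  exists2 r, 0 < r & forall z a, D z -> `|z - x| < r -> 0 < a < r ->
    f (z + a *: (y z - z)) <= f z - beta * a * enorm (y z - z) ^+ 2.
Proof.
move=> fl /subspace_continuousP yc Dx yx bt yd.
have [L [r0 fx_lip]] := locally_lipschitz_ball fl Dx.
have [L0 r00 HL] := fx_lip.
set d := y x - x; set N := enorm d ^+ 2.
have N0 : 0 < N by apply: enorm_sqr_gt0; rewrite subr_eq0; exact/eqP.
(* Three errors of size [c] arise: in the upper limit, in the change of
   direction, and in the squared length of the direction. *)
pose c := (tau - beta) * N / 4.
have tbN : 0 < (tau - beta) * N by rewrite mulr_gt0// subr_gt0.
have c0 : 0 < c by rewrite divr_gt0.
have wF : Filter (within D (nbhs x)) := within_filter D (nbhs_filter x).
have dc : (y z - z) @[z --> within D (nbhs x)] --> d.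
  apply: cvgB; first exact: yc.
  by apply: cvg_within_filter.
have Nc := cvg_enorm_sqr wF dc.
have [g gP gd] := gengrad_attains fx_lip d.
have : (clarke_upper f x d <= (- tau * N)%:E)%E.
  by apply: le_trans gd _; rewrite lee_fin; exact: yd.
move=> /clarke_leP /(_ _ c0) [r1 r10 H1].
have [r2 r20 H2] : exists2 s, 0 < s & forall z, `|z - x| < s -> D z ->
    L * `|y z - z - d| <= c /\ beta * enorm (y z - z) ^+ 2 <= beta * N + c.
  have h1 : \forall z \near within D (nbhs x), L * `|y z - z - d| <= c.
    have /cvgrPdist_lt/(_ _ (divr_gt0 c0 L0)) := dc.
    apply: filterS => z; rewrite distrC ltr_pdivlMr// mulrC.
    exact: ltW.
  have h2 : \forall z \near within D (nbhs x),
      beta * enorm (y z - z) ^+ 2 <= beta * N + c.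
    have Nbc : beta * enorm (y z - z) ^+ 2 @[z --> within D (nbhs x)]
        --> beta * N by apply: cvgM => //; exact: cvg_cst.
    have : beta * N < beta * N + c by rewrite ltrDl.
    by move/(cvgr_lt _ Nbc); apply: filterS => z /ltW.
  have /(@nbhs_normP R 'rV[R]_n)[s /= s0 sH] : nbhs x [set z | D z ->
      L * `|y z - z - d| <= c /\ beta * enorm (y z - z) ^+ 2 <= beta * N + c].
    exact: filterI h1 h2.
  by exists s => // z zx Dz; apply: sH => //=; rewrite distrC.
have r020 : 0 < r0 / 2 by rewrite divr_gt0.
have [r3 r30 H3] := small_step x d r020.
have r40 : 0 < r0 / 2 / (c / L) by rewrite !divr_gt0.
exists (Num.min (Num.min r1 r2) (Num.min r3 (r0 / 2 / (c / L)))).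
  by rewrite !lt_min r10 r20 r30 r40.
move=> z a Dz; rewrite !lt_min => /andP[/andP[z1 z2] /andP[z3 _]].
move=> /andP[a0 /andP[/andP[a1 _] /andP[a3 a4]]].
have [h1 h2] := H2 z z2 Dz.
have := H1 z a z1; rewrite a0 a1 => /(_ isT) h3.
have := H3 z a z3; rewrite a0 a3 => /(_ isT) [_ h4].
have ezd : z + a *: (y z - z) - (z + a *: d) = a *: (y z - z - d).
  by rewrite opprD addrACA subrr add0r -scalerBr.
have h5 : `|a *: (y z - z - d)| < r0 / 2.
  rewrite normrZ gtr0_norm//.
  have h1' : `|y z - z - d| <= c / L by rewrite ler_pdivlMr// mulrC.
  apply: (@le_lt_trans _ _ (a * (c / L))); first by rewrite ler_pM2l.
  by rewrite -ltr_pdivlMr// divr_gt0.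
have h6 : `|f (z + a *: (y z - z)) - f (z + a *: d)| <= a * c.
  apply: le_trans (HL _ _ _ _) _; last first.
  - by rewrite ezd normrZ gtr0_norm// mulrCA ler_pM2l.
  - by lra.
  rewrite -(subrK (z + a *: d) (z + a *: (y z - z))) ezd -addrA.
  by apply: le_lt_trans (ler_normD _ _) _; lra.
have := le_trans (ler_norm _) h6 => {}h6.
have h7 : a * (beta * enorm (y z - z) ^+ 2) <= a * (beta * N + c).
  by rewrite ler_pM2l.
have h8 : a * (- tau * N + c) + a * c + a * (beta * N + c) <= 0.
  by rewrite -!mulrDr pmulr_rle0// /c; lra.
rewrite mulrAC -mulrA in h7 *.
lra.
Qed.

(** * Subsequences *)

Section Subsequences.
Local Close Scope ring_scope.

(** The image of [\oo] restricted to [P] is a proper filter on [A], so it has a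
cluster point; a subsequence is then chosen greedily inside balls of radius
[j.+1%:R^-1]. *)
Lemma frequently_subseq (R : realType) (V : normedModType R) (x : nat -> V)
    (A : set V) (P : nat -> Prop) : compact A ->
  (forall k, A (x k)) -> (forall K, exists2 k, K <= k & P k) ->
  exists z (phi : nat -> nat), [/\ {homo phi : i j / i < j},
    forall j, P (phi j), A z & x (phi j) @[j --> \oo] --> z].
Proof.
move=> cA Ax Pinf.
pose F := x @ within P \oo.
have FF : ProperFilter F.
  apply: Build_ProperFilter => - [K _ KP].
  by have [k Kk Pk] := Pinf K; apply: KP Pk.
have FA : F A by exists 0 => // k _ _; exact: Ax.
have [z [Az zF]] := cA F FF FA.
have near_z (K j : nat) : {k | [/\ K <= k, P k &
    (`|z - x k| < j.+1%:R^-1)%R]}.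
  apply: cid.
  have FK : F [set x k | k in [set k | K <= k /\ P k]].
    by exists K => // k /= Kk Pk; exists k.
  have [_ [[k [Kk Pk] <-] zk]] :=
    zF _ _ FK (nbhsx_ballx z (j.+1%:R^-1)%R ltac:(by [])).
  by exists k; split => //; move: zk; rewrite -ball_normE.
pose phi := fix phi j := if j is i.+1 then sval (near_z (phi i).+1 j)
                         else sval (near_z 0 0).
exists z, phi; split => // [|j|].
- apply: homo_ltn => [|j]; first exact: ltn_trans.
  by rewrite [in X in _ < X]/=; case: (near_z (phi j).+1 j.+1) => ? [].
- by case: j => [|j] /=;
    [case: (near_z 0 0)|case: (near_z (phi j).+1 _)] => ? [].
apply/cvgrPdist_lt => e e0.
have := near_infty_natSinv_lt (PosNum e0).
apply: filterS => j /=; apply: lt_trans.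
by case: j => [|j] /=;
    [case: (near_z 0 0)|case: (near_z (phi j).+1 _)] => ? [].
Qed.

Lemma homo_ltn_ge (phi : nat -> nat) :
  {homo phi : i j / i < j} -> forall j, j <= phi j.
Proof.
by move=> phi_incr; elim=> // j IH; apply: leq_ltn_trans IH _; exact: phi_incr.
Qed.

Lemma homo_ltn_cvg (phi : nat -> nat) :
  {homo phi : i j / i < j} -> phi @ \oo --> \oo.
Proof.
move=> phi_incr P [K _ KP]; exists K => // j /= Kj; apply: KP => /=.
exact: leq_trans Kj (homo_ltn_ge phi_incr j).
Qed.

End Subsequences.

(** * Runs of the method *)

Section Steps.
Variables (R : realType) (n : nat) (f : 'rV[R]_n -> R) (gamma : R).
Variables (y : 'rV[R]_n -> 'rV[R]_n) (beta : R) (taus : nat -> R).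
Variables (s s' : sbm_state R n).
Hypothesis ss' : sbm_step f gamma y beta taus s s'.

Lemma sbm_step_descent : sbm_descent f y beta s ->
  [/\ iter_pt s' = sbm_trial y s, stepsize s <= stepsize s' &
      level s' = level s].
Proof. by case: ss' => [lam _ _ /andP[]|lam _ +|lam _ +]. Qed.

Lemma sbm_step_fail : ~ sbm_descent f y beta s ->
  level s' = (level s).+1 /\
  (iter_pt s' = sbm_trial y s \/ iter_pt s' = best_pt s).
Proof.
by case: ss' => [lam _ d _ /(_ d) //|lam _ _ _ _ _|lam _ _ _ _ _] /=;
  split=> //; [left|right].
Qed.

Lemma sbm_step_level : (level s <= level s')%N.
Proof.
have [/sbm_step_descent[_ _ ->]//|/sbm_step_fail[-> _]] :=
  pselect (sbm_descent f y beta s).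
exact: leqnSn.
Qed.

End Steps.

Lemma sublevel_closed (R : realType) (n : nat) (D : set 'rV[R]_n)
    (f : 'rV[R]_n -> R) (gamma : R) :
  closed D -> (forall z, D z -> {for z, continuous f}) ->
  closed (sublevel D f gamma).
Proof.
move=> clD fc z cz.
have Dz : D z by apply: clD => B /cz[w [[Dw _] Bw]]; exists w.
split => //; rewrite leNgt; apply/negP => gz.
have [w [[_ wg] gw]] := cz _ (cvgr_gt _ (fc z Dz) _ gz).
by move: (lt_le_trans gw wg); rewrite ltxx.
Qed.

Section Run.
Variables (R : realType) (n : nat) (D : set 'rV[R]_n) (f : 'rV[R]_n -> R).
Variables (gamma : R) (y : 'rV[R]_n -> 'rV[R]_n) (tau beta : R).
Variables (taus : nat -> R) (s : nat -> sbm_state R n).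
Hypotheses (D_convex : convex_set D) (D_closed : closed D).
Hypothesis f_lip : locally_lipschitz_on D f.
Hypothesis Dgamma_bounded : bounded_set (sublevel D f gamma).
Hypothesis y_map : forall z, D z -> D (y z).
Hypothesis y_cont : {within D, continuous y}.
Hypothesis y_fix : forall z, D z -> (z = y z <-> stationary D f z).
Hypothesis y_descent : forall z g, D z -> gengrad f z g ->
  dotv g (y z - z) <= - tau * enorm (y z - z) ^+ 2.
Hypotheses (beta_gt0 : 0 < beta) (beta_lt_tau : beta < tau).
Hypotheses (taus01 : forall l, 0 < taus l < 1).
Hypothesis taus0 : taus l @[l --> \oo] --> 0.
Hypothesis s_init : sbm_init D f gamma taus (s 0%N).
Hypothesis s_step : forall k, sbm_step f gamma y beta taus (s k) (s k.+1).

Local Notation x k := (iter_pt (s k)).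
Local Notation dir z := (y z - z).
Local Notation fails k := (~ sbm_descent f y beta (s k)).

Lemma trial_domain k : D (x k) -> 0 < stepsize (s k) < 1 ->
  D (sbm_trial y (s k)).
Proof.
move=> Dx /andP[s0 s1].
have := D_convex (Itv01 (ltW s0) (ltW s1)) (mem_set (y_map Dx)) (mem_set Dx).
rewrite inE /conv /=; congr D.
by rewrite /sbm_trial /unstable.onem scalerBl scale1r scalerBr addrCA.
Qed.

Lemma run_invariant k :
  [/\ sublevel D f gamma (x k), sublevel D f gamma (best_pt (s k)),
      f (best_pt (s k)) <= f (x k) &
      0 < stepsize (s k) <= taus (level (s k))].
Proof.
elim: k => [|k [[Dx fx] [Du fu] ux /andP[st0 stt]]].
  by have [? -> ? ->] := s_init.
have Dt : D (sbm_trial y (s k)).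
  apply: trial_domain => //; rewrite st0 (le_lt_trans stt)//.
  by case/andP: (taus01 (level (s k))).
have best t : D t -> f t <= gamma ->
    sublevel D f gamma (sbm_best f (best_pt (s k)) t) /\
    f (sbm_best f (best_pt (s k)) t) <= f t.
  by move=> ? ?; rewrite /sbm_best; case: ltP.
case: (s_step k) => lam ? desc; rewrite /= ?le_min.
- move=> /andP[sl lt].
  have ft : f (sbm_trial y (s k)) <= gamma.
    apply: le_trans desc (le_trans _ fx); rewrite gerBl.
    by rewrite mulr_ge0 ?sqr_ge0// mulr_ge0// ltW.
  have [? ?] := best _ Dt ft; split => //.
  by rewrite (lt_le_trans st0 sl).
- move=> /and3P[l0 _ lt] ft.
  by have [? ?] := best _ Dt ft; split => //; rewrite l0.
- move=> /and3P[l0 _ lt] _.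
  by split => //; rewrite l0.
Qed.

Lemma run_domain k : D (x k).
Proof. by have [[]] := run_invariant k. Qed.

Lemma run_step_gt0 k : 0 < stepsize (s k).
Proof. by have [_ _ _ /andP[]] := run_invariant k. Qed.

Lemma descent_decrease k : sbm_descent f y beta (s k) ->
  f (x k.+1) <= f (x k) - beta * stepsize (s k) * enorm (dir (x k)) ^+ 2.
Proof. by move=> dk; have [-> _ _] := sbm_step_descent (s_step k) dk. Qed.

Lemma descent_le k : sbm_descent f y beta (s k) -> f (x k.+1) <= f (x k).
Proof.
move=> /descent_decrease /le_trans; apply; rewrite gerBl.
by rewrite mulr_ge0 ?sqr_ge0// mulr_ge0 ?ltW// run_step_gt0.
Qed.

(** Each failure raises the level, and the step is bounded by [taus] at the
current level. *)
Lemma steps_vanish : (forall K, exists2 k, (K <= k)%N & fails k) ->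
  stepsize (s k) @[k --> \oo] --> 0.
Proof.
move=> inf_fails.
have level_le i k : (level (s k) <= level (s (i + k)))%N.
  elim: i => // i IH; apply: leq_trans IH _.
  exact: sbm_step_level (s_step (i + k)).
have level_large l : \forall k \near \oo, (l <= level (s k))%N.
  elim: l => [|l [K _ HK]]; first by exists 0%N.
  have [k Kk fk] := inf_fails K; exists k.+1 => // j /= kj.
  rewrite -(subnK kj); apply: leq_trans (level_le _ _).
  by have [-> _] := sbm_step_fail (s_step k) fk; rewrite ltnS; exact: HK.
apply/cvgrPdist_lt => e e0.
have /cvgrPdist_lt/(_ _ e0)[l _ Hl] := taus0.
apply: filterS (level_large l) => k lk.
have [_ _ _ /andP[s0 st]] := run_invariant k.
have := Hl _ lk; rewrite !sub0r !normrN !gtr0_norm ?(lt_le_trans s0 st)//.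
exact: le_lt_trans.
Qed.

Lemma fails_steps_vanish phi : {homo phi : i j / (i < j)%N} ->
  (forall j, fails (phi j)) -> stepsize (s (phi j)) @[j --> \oo] --> 0.
Proof.
move=> phi_incr phi_fails.
apply: cvg_comp (homo_ltn_cvg phi_incr) (steps_vanish _) => K.
by exists (phi K); [exact: homo_ltn_ge|].
Qed.

Lemma f_continuous z : D z -> {for z, continuous f}.
Proof.
move=> /(locally_lipschitz_ball f_lip)[L [r]].
exact: lipschitz_ball_continuous.
Qed.

Section LimitPoint.
Variables (phi : nat -> nat) (z : 'rV[R]_n).
Hypothesis phi_incr : {homo phi : i j / (i < j)%N}.
Hypothesis xz : x (phi j) @[j --> \oo] --> z.

Lemma limit_domain : D z.
Proof.
apply: (closed_cvg _ D_closed _ _ xz).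
by apply: nearW => j; exact: run_domain.
Qed.

Lemma limit_value : f (x (phi j)) @[j --> \oo] --> f z.
Proof. exact: cvg_comp xz (f_continuous limit_domain). Qed.

Lemma limit_direction : dir (x (phi j)) @[j --> \oo] --> dir z.
Proof.
apply: cvgB => //.
have /subspace_continuousP/(_ _ limit_domain) := y_cont.
apply: cvg_comp => P zP.
have : \forall j \near \oo, D (x (phi j)) -> P (x (phi j)) by exact: xz zP.
by apply: filterS => j; apply; exact: run_domain.
Qed.

Lemma stationary_limit : y z = z -> stationary D f z.
Proof. by move=> yz; apply/(y_fix limit_domain). Qed.

(** If [z] were not a fixed point of [y], the small steps taken near [z] would all
pass the descent test. *)
Lemma fails_limit : (forall j, fails (phi j)) -> stationary D f z.
Proof.
move=> phi_fails; apply: stationary_limit; apply: contrapT => yz.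
have st0 := fails_steps_vanish phi_incr phi_fails.
have [r r0 Hr] := locally_uniform_descent f_lip y_cont limit_domain yz
  beta_lt_tau (fun g => y_descent limit_domain).
have /cvgrPdist_lt/(_ _ r0) := xz.
have /cvgrPdist_lt/(_ _ r0) := st0.
move=> /filterI /[apply] /filter_ex[j [/=]].
rewrite sub0r normrN gtr0_norm ?run_step_gt0// => sr xr.
apply: (phi_fails j); apply: Hr; rewrite ?run_step_gt0//.
- exact: run_domain.
- by rewrite distrC.
Qed.

(** Without failures the step never shrinks, so each visit near a point [z] that
is not fixed by [y] would lower [f] by a fixed amount. Passing to the limit in
the decrease between two consecutive visits yields [f z < f z]. *)
Lemma nofails_limit K : (forall k, (K <= k)%N -> sbm_descent f y beta (s k)) ->
  stationary D f z.
Proof.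
move=> nofails; apply: stationary_limit; apply: contrapT => yz.
have N0 : 0 < enorm (dir z) ^+ 2.
  by apply: enorm_sqr_gt0; rewrite subr_eq0; exact/eqP.
have b0 : 0 < beta * stepsize (s K) by rewrite mulr_gt0 ?run_step_gt0.
have step_le i : stepsize (s K) <= stepsize (s (i + K)).
  elim: i => // i /le_trans; apply.
  by have [] := sbm_step_descent (s_step (i + K)) (nofails _ (leq_addl i K)).
have mono i k : (K <= k)%N -> f (x (i + k)) <= f (x k).
  move=> Kk; elim: i => // i; apply: le_trans; apply: descent_le.
  by apply: nofails; exact: leq_trans Kk (leq_addl _ _).
have drop j : (K <= j)%N -> f (x (phi j.+1)) <=
    f (x (phi j)) - beta * stepsize (s K) * enorm (dir (x (phi j))) ^+ 2.
  move=> Kj; have Kp := leq_trans Kj (homo_ltn_ge phi_incr j).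
  have := mono (phi j.+1 - (phi j).+1)%N _ (leqW Kp).
  rewrite subnK ?phi_incr// => /le_trans; apply.
  apply: le_trans (descent_decrease (nofails _ Kp)) _.
  rewrite lerD2l lerN2 ler_wpM2r ?sqr_ge0// ler_pM2l//.
  by rewrite -(subnK Kp).
have lim_drop : f z <= f z - beta * stepsize (s K) * enorm (dir z) ^+ 2.
  have lim1 : f (x (phi j.+1)) @[j --> \oo] --> f z.
    by have := limit_value; rewrite -(cvg_shiftS (fun j => f (x (phi j)))).
  have lim2 : f (x (phi j)) -
      beta * stepsize (s K) * enorm (dir (x (phi j))) ^+ 2 @[j --> \oo] -->
      f z - beta * stepsize (s K) * enorm (dir z) ^+ 2.
    apply: cvgB; first exact: limit_value.
    apply: cvgM; first exact: cvg_cst.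
    exact: cvg_enorm_sqr limit_direction.
  by apply: ler_cvg_to lim1 lim2 _; exists K => // j /= /drop.
have := mulr_gt0 b0 N0; lra.
Qed.

End LimitPoint.

Lemma run_subseq (P : nat -> Prop) :
  (forall K, exists2 k, (K <= k)%N & P k) ->
  exists (z : 'rV[R]_n) (phi : nat -> nat),
    [/\ {homo phi : i j / (i < j)%N}, forall j, P (phi j) &
    x (phi j) @[j --> \oo] --> z].
Proof.
move=> Pinf.
have cS : compact (sublevel D f gamma).
  apply: bounded_closed_compact => //.
  by apply: sublevel_closed => //; exact: f_continuous.
have xS k : sublevel D f gamma (x k) by have [] := run_invariant k.
have [z [phi [? ? _ ?]]] := frequently_subseq cS xS Pinf.
by exists z, phi.
Qed.

Lemma run_dichotomy :
  (forall K, exists2 k, (K <= k)%N & fails k) \/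
  (exists K, forall k, (K <= k)%N -> sbm_descent f y beta (s k)).
Proof.
apply: contrapT => /not_orP[/existsNP[K HK] H2]; apply: H2; exists K => k Kk.
by apply: contrapT => fk; apply: HK; exists k.
Qed.

Lemma stationary_limit_exists :
  exists z, subseq_limit (fun k => x k) z /\ stationary D f z.
Proof.
have [inf_fails|[K nofails]] := run_dichotomy.
  have [z [phi [phi_incr phi_fails xz]]] := run_subseq inf_fails.
  by exists z; split; [exists phi|exact: fails_limit phi_incr xz phi_fails].
have all_inf j : exists2 k, (j <= k)%N & True by exists j.
have [z [phi [phi_incr _ xz]]] := run_subseq all_inf.
by exists z; split; [exists phi|exact: nofails_limit phi_incr xz _ nofails].
Qed.

(** The steps vanish and the directions converge, so the failing trial points
have the same limit as the iterates. *)
Lemma trial_limit phi z : {homo phi : i j / (i < j)%N} ->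
  (forall j, fails (phi j)) -> x (phi j) @[j --> \oo] --> z ->
  f (sbm_trial y (s (phi j))) @[j --> \oo] --> f z.
Proof.
move=> phi_incr phi_fails xz.
have st0 := fails_steps_vanish phi_incr phi_fails.
have trial_z : sbm_trial y (s (phi j)) @[j --> \oo] --> z.
  have := cvgD xz (cvgZ st0 (limit_direction xz)).
  by rewrite scale0r addr0; exact.
exact: cvg_comp trial_z (f_continuous (limit_domain xz)).
Qed.

(** [f] can only increase at a failure. The values after late failures are below
[m + e], since a subsequence of counterexamples would accumulate at a
stationary point, at which [f] is [m]. So once a value is below [m + e], all
the later ones are. *)
Lemma values_below (m e : R) : (forall z, stationary D f z -> f z = m) ->
  0 < e -> \forall k \near \oo, f (x k) < m + e.
Proof.
move=> st_m e0.
have me : m < m + e by rewrite ltrDl.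
have [K0 fails_below] : exists K0, forall k, (K0 <= k)%N -> fails k ->
    f (x k.+1) < m + e.
  apply: contrapT => /forallNP noK0.
  have inf_fails K :
      exists2 k, (K <= k)%N & fails k /\ m + e <= f (x k.+1).
    have /existsNP[k /not_implyP[Kk /not_implyP[fk /negP]]] := noK0 K.
    by rewrite -leNgt; exists k.
  have [z [phi [phi_incr phi_P xz]]] := run_subseq inf_fails.
  have phi_fails j := (phi_P j).1.
  have fz := st_m _ (fails_limit phi_incr xz phi_fails).
  have := limit_value xz; rewrite fz => /(cvgr_lt _)/(_ _ me) h1.
  have := trial_limit phi_incr phi_fails xz.
  rewrite fz => /(cvgr_lt _)/(_ _ me) h2.
  have [j [/= xj tj]] := filter_ex (filterI h1 h2).
  have := (phi_P j).2; rewrite leNgt => /negP; apply.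
  have [_ [->//|->]] := sbm_step_fail (s_step (phi j)) (phi_fails j).
  have [_ _ ux _] := run_invariant (phi j).
  exact: le_lt_trans ux xj.
have [K K0K xK] : exists2 K, (K0 <= K)%N & f (x K) < m + e.
  have [inf_fails|[K1 nofails]] := run_dichotomy.
    have [k Kk fk] := inf_fails K0.
    by exists k.+1; [exact: leqW|exact: fails_below].
  have [z [[phi phi_incr xz] sz]] := stationary_limit_exists.
  have := limit_value xz; rewrite st_m// => /(cvgr_lt _)/(_ _ me) h1.
  have [j [/= Kj xj]] := filter_ex (filterI (nbhs_infty_ge K0) h1).
  by exists (phi j) => //; exact: leq_trans Kj (homo_ltn_ge phi_incr j).
exists K => // k /= /subnK <-; elim: (k - K)%N => // i IH.
have [dk|fk] := pselect (sbm_descent f y beta (s (i + K))).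
  exact: le_lt_trans (descent_le dk) IH.
by apply: fails_below fk; exact: leq_trans K0K (leq_addl _ _).
Qed.

Lemma values_cvg_optval : solutions D f = stationary D f ->
  (f (x k))%:E @[k --> \oo] --> optval D f.
Proof.
move=> sol_st.
have [z [_ sz]] := stationary_limit_exists.
have [Dz fz] : solutions D f z by rewrite sol_st.
have st_f w : stationary D f w -> f w = f z.
  by rewrite -sol_st => -[_]; rewrite -fz => -[].
have f_ge w : D w -> f z <= f w.
  by move=> Dw; rewrite -lee_fin fz; apply: ereal_inf_lbound; exists w.
rewrite -fz; apply: cvg_EFin; first exact: nearW.
apply/cvgrPdist_lt => e e0; apply: filterS (values_below st_f e0) => k /= fk.
have := f_ge _ (run_domain k).
by rewrite distrC => h; rewrite ger0_norm ?subr_ge0// ltrBlDl.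
Qed.

Lemma limits_are_solutions : solutions D f = stationary D f ->
  forall z, subseq_limit (fun k => x k) z -> solutions D f z.
Proof.
move=> sol_st z [phi phi_incr xz].
split; first exact: limit_domain xz.
have lim1 : (f (x (phi j)))%:E @[j --> \oo] --> optval D f.
  exact: cvg_comp (homo_ltn_cvg phi_incr) (values_cvg_optval sol_st).
have lim2 : (f (x (phi j)))%:E @[j --> \oo] --> (f z)%:E.
  by apply: cvg_EFin; [exact: nearW|exact: limit_value].
exact: cvg_unique lim2 lim1.
Qed.

End Run.

Theorem theorem1 (R : realType) (n : nat) (D : set 'rV[R]_n)
    (f : 'rV[R]_n -> R) (gamma : R) (y : 'rV[R]_n -> 'rV[R]_n)
    (tau beta : R) (x : nat -> 'rV[R]_n)
    (D_neq0 : D !=set0) (D_convex : convex_set D) (D_closed : closed D)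
    (f_lip : locally_lipschitz_on D f)
    (gamma_gt : (optval D f < gamma%:E)%E)
    (Dgamma_bounded : bounded_set (sublevel D f gamma))
    (y_map : forall z, D z -> D (y z))
    (tau_gt0 : 0 < tau)
    (y_cont : {within D, continuous y})
    (y_fix : forall z, D z -> (z = y z <-> stationary D f z))
    (y_descent : forall z g, D z -> gengrad f z g ->
       dotv g (y z - z) <= - tau * enorm (y z - z) ^+ 2)
    (beta01 : 0 < beta < 1) (beta_lt_tau : beta < tau)
    (x_sbm : sbm_sequence D f gamma y beta x) :
  (exists z, subseq_limit x z /\ stationary D f z) /\
  (solutions D f = stationary D f ->
     (forall z, subseq_limit x z -> solutions D f z) /\
     (f (x k))%:E @[k --> \oo] --> optval D f).
Proof.
have [beta_gt0 _] := andP beta01.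
have [taus [s [[taus01 taus0] s_init s_step xE]]] := x_sbm.
have -> : x = fun k => iter_pt (s k) by apply/funext.
split; first exact: (@stationary_limit_exists _ _ D f gamma y tau beta taus).
move=> sol_st; split.
  exact: (@limits_are_solutions _ _ D f gamma y tau beta taus).
exact: (@values_cvg_optval _ _ D f gamma y tau beta taus).
Qed.
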